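(* Let $y=y(x)$ satisfy $2\leqslant y\leqslant x$ and $y/\log x\to\infty$ as $x\to\infty$. Then \[ |\mathcal{S}(x,y)\cdot\mathcal{S}(x,y)|=\Psi(x,y)^{2+o(1)}\qquad(x\to\infty), \] i.e., $\log|\mathcal{S}(x,y)\cdot\mathcal{S}(x,y)|/\log\Psi(x,y)\to 2$ as $x\to\infty$.
   Context: For real $x\geqslant y\geqslant 2$, $\mathcal{S}(x,y)=\{n\in\mathbb{Z}_{\geqslant 1} : n\leqslant x,\ P^+(n)\leqslant y\}$, where $P^+(n)$ denotes the largest prime factor of an integer $n\geqslant 2$ and $P^+(1)=1$, and $\Psi(x,y)=|\mathcal{S}(x,y)|$. For a set $\mathcal{A}$ of integers, $\mathcal{A}\cdot\mathcal{A}=\{aa' : a,a'\in\mathcal{A}\}$. $\log$ is the natural logarithm. *)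

(* Defs.v *)
From mathcomp Require Import all_boot all_order all_algebra finmap.
From mathcomp Require Import all_classical all_reals all_analysis.

Set Implicit Arguments.
Unset Strict Implicit.
Unset Printing Implicit Defensive.

Import Order.TTheory GRing.Theory Num.Theory.
Import numFieldNormedType.Exports.

Local Open Scope classical_set_scope.
Local Open Scope ring_scope.

(* P^+(n) is [max_pdiv n]: the largest prime divisor of n for n > 1, and 1 for
   n = 1. *)
Definition smooth_set (R : realType) (x y : R) : set nat :=
  [set n : nat | [/\ (1 <= n)%N, n%:R <= x & (max_pdiv n)%:R <= y]].

Definition product_set (A B : set nat) : set nat :=
  [set (a * b)%N | a in A & b in B].

(* [fset_set A] is empty when A is infinite; [finite_smooth_set] and
   [finite_product_set] show that this never happens for the sets counted
   in the theorem. *)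
Definition set_card (A : set nat) : nat := #|` fset_set A|.

Definition Psi (R : realType) (x y : R) : nat := set_card (smooth_set x y).

Lemma finite_smooth_set (R : realType) (x y : R) : finite_set (smooth_set x y).
Proof.
apply: (sub_finite_set _ (finite_II (Num.truncn x).+1)) => n /= [n_gt0 le_nx _].
have x_ge0 : 0 <= x by apply: le_trans le_nx; rewrite ler0n.
by rewrite ltnS truncn_ge_nat.
Qed.

Lemma finite_product_set (A B : set nat) :
  finite_set A -> finite_set B -> finite_set (product_set A B).
Proof. exact: finite_image2. Qed.

(* Main.v *)
(** Every product set satisfies |A.A| * max tau(ab) >= |A|^2, because an element
    n of A.A is a product ab in at most tau(n) ways. With l = log x, splitting
    n <= x^2 at the primes around sqrt l gives the classical bound
    log tau(n) = O(l / log l). Counting products of u = floor(l / log y)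
    distinct primes up to y, Chebyshev's lower bound for pi(y) and
    binomial(pi(y), u) >= (pi(y) / 2u)^u give
    log Psi(x, y) >> (l / log y) log(y / l). Writing k = y / l and
    log y = log k + log l, the quotient log tau / log Psi is
    O(1 / log l + 1 / log k), which tends to 0. *)

Require Import Defs.
From mathcomp Require Import all_boot all_order all_algebra finmap.
From mathcomp Require Import all_classical all_reals all_analysis.
From mathcomp Require Import zify.
From mathcomp Require Import ring lra.

Import Order.TTheory GRing.Theory Num.Theory.
Import numFieldNormedType.Exports.

Local Open Scope nat_scope.

(** * Divisor counts *)

(** A divisor [d] of [m * n] is sent injectively to [g = gcdn d m] and [d %/ g]. The latter is
    coprime to [m %/ g], so it divides [n] by Gauss's lemma. *)
Lemma size_divisorsM (m n : nat) : 0 < m -> 0 < n ->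
  size (divisors (m * n)) <= size (divisors m) * size (divisors n).
Proof.
move=> m0 n0.
rewrite -(size_allpairs pair) -(size_map (fun d => (gcdn d m, d %/ gcdn d m))).
apply: uniq_leq_size => [|_ /mapP[d dmn ->]].
  rewrite map_inj_uniq ?divisors_uniq // => d e [+ Ee].
  by move=> Eg; rewrite -(divnK (dvdn_gcdl d m)) Ee Eg divnK ?dvdn_gcdl.
move: dmn; rewrite -dvdn_divisors ?muln_gt0 ?m0 // => dmn.
have g0 : 0 < gcdn d m by rewrite gcdn_gt0 m0 orbT.
apply/allpairs_f; rewrite -dvdn_divisors ?dvdn_gcdr //.
have cop : coprime (d %/ gcdn d m) (m %/ gcdn d m).
  rewrite /coprime -(eqn_pmul2r g0) mul1n muln_gcdl.
  by rewrite !divnK ?dvdn_gcdl ?dvdn_gcdr.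
rewrite -(Gauss_dvdr _ cop) -(dvdn_pmul2r g0) divnK ?dvdn_gcdl //.
by rewrite mulnAC divnK ?dvdn_gcdr.
Qed.

Lemma size_divisors_gt0 (n : nat) : 0 < size (divisors n).
Proof. by have := divisor1 n; case: (divisors n). Qed.

Lemma size_divisors_prime_le2 (p : nat) : prime p -> size (divisors p) <= 2.
Proof.
move=> pp; apply: (@leq_trans (size [:: 1; p])) => //.
apply: uniq_leq_size; rewrite ?divisors_uniq // => d.
rewrite -dvdn_divisors ?prime_gt0 // !inE.
by case/primeP: pp => _ /[apply].
Qed.

(** The witness [k] is the number of prime factors with multiplicity: each at most doubles the
    divisor count and contributes a factor at least [P] to [n]. *)
Lemma size_divisors_rough (P n : nat) : 0 < n ->
  (forall p, prime p -> p %| n -> P <= p) ->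
  exists k, size (divisors n) <= 2 ^ k /\ P ^ k <= n.
Proof.
elim/ltn_ind: n => n IH n0 rough.
have [n1|n1] := leqP n 1.
  by exists 0; have -> : n = 1 by apply/eqP; rewrite eqn_leq n1.
have pp := pdiv_prime n1; set p := pdiv n in pp.
have En : p * (n %/ p) = n by rewrite mulnC divnK ?pdiv_dvd.
have m0 : 0 < n %/ p by rewrite divn_gt0 ?prime_gt0 // pdiv_leq.
have [||k [Hk1 Hk2]] := IH (n %/ p) _ m0.
- by rewrite ltn_Pdiv ?prime_gt1.
- by move=> q pq qn; apply: rough => //; rewrite -En dvdn_mull.
exists k.+1; rewrite !expnS -En; split.
  apply: leq_trans (size_divisorsM _ _ (prime_gt0 pp) m0) _.
  by rewrite leq_mul ?size_divisors_prime_le2.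
by rewrite leq_mul // rough // pdiv_dvd.
Qed.

(** A divisor is determined by its exponents at the primes below [P], and each exponent is at most
    [L] because primes are at least 2. *)
Lemma size_divisors_smooth (P L n : nat) : 0 < n -> n <= 2 ^ L ->
  (forall p, prime p -> p %| n -> p < P) ->
  size (divisors n) <= L.+1 ^ P.
Proof.
move=> n0 nL smooth.
pose f d : {ffun 'I_P -> 'I_L.+1} := [ffun p : 'I_P => inord (logn p d)].
have -> : L.+1 ^ P = #|{: {ffun 'I_P -> 'I_L.+1}}|.
  by rewrite card_ffun !card_ord.
rewrite cardE -(size_map f); apply: uniq_leq_size => [|g _]; last first.
  by rewrite mem_enum.
rewrite map_inj_in_uniq ?divisors_uniq // => d e.
rewrite -!dvdn_divisors // => dn en /ffunP Ede.
have d0 := dvdn_gt0 n0 dn; have e0 := dvdn_gt0 n0 en.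
have logL c p : c %| n -> logn p c <= L.
  move=> cn; have c0 := dvdn_gt0 n0 cn.
  have [pp|pp] := boolP (prime p); last by rewrite lognE (negPf pp).
  rewrite -(leq_exp2l _ _ (isT : 1 < 2)).
  apply: leq_trans nL; apply: leq_trans (dvdn_leq n0 cn).
  apply: leq_trans (dvdn_leq c0 (pfactor_dvdnn p c)).
  by case: (logn p c) => // i; rewrite leq_exp2r ?prime_gt1.
have log0 c p : c %| n -> P <= p -> logn p c = 0.
  move=> cn Pp; apply/eqP; rewrite -leqn0 leqNgt logn_gt0 mem_primes.
  apply/and3P => -[pp _ pc]; have := smooth p pp (dvdn_trans pc cn).
  by rewrite ltnNge Pp.
apply: eqn_from_log => // p.
have [Pp|pP] := leqP P p; first by rewrite !log0.
have := Ede (Ordinal pP); rewrite !ffunE => /(congr1 val) /=.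
by rewrite !inordK ?ltnS ?logL.
Qed.

(** The smooth bound applies to the part of [n] at primes below [P], the rough bound to the
    complementary part. *)
Lemma size_divisors_le (P L n : nat) : 0 < n -> n <= 2 ^ L ->
  exists k, size (divisors n) <= L.+1 ^ P * 2 ^ k /\ P ^ k <= n.
Proof.
move=> n0 nL; pose small : nat_pred := [pred p | p < P].
have [|k [Hk1 Hk2]] := @size_divisors_rough P n`_(small^') (part_gt0 _ _).
  move=> p pp pn; have := pnatP _ (part_gt0 _ _) (part_pnat small^' n).
  by move=> /(_ p pp pn); rewrite !inE -leqNgt.
exists k; split; last exact: leq_trans Hk2 (dvdn_leq n0 (dvdn_part _ _)).
rewrite -[in leqLHS](partnC small n0).
apply: leq_trans (size_divisorsM _ _ (part_gt0 _ _) (part_gt0 _ _)) _.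
apply: leq_mul Hk1; apply: size_divisors_smooth; rewrite ?part_gt0 //.
  exact: leq_trans (dvdn_leq n0 (dvdn_part _ _)) nL.
move=> p pp pn; have := pnatP _ (part_gt0 _ _) (part_pnat small n).
by move=> /(_ p pp pn).
Qed.

(** A pair [(a, b)] is recovered from [a * b] and the position of [a] among its divisors, so each
    product comes from at most [T] pairs. *)
Lemma size_undup_products (s : seq nat) (T : nat) : uniq s ->
  {in s, forall a, 0 < a} ->
  {in s &, forall a b, size (divisors (a * b)) <= T} ->
  size s ^ 2 <= size (undup [seq a * b | a <- s, b <- s]) * T.
Proof.
move=> us s0 sT.
rewrite -mulnn -(size_allpairs pair s s) -[X in _ <= _ * X](size_iota 0).
rewrite -(size_allpairs pair).
pose f (c : nat * nat) := (c.1 * c.2, index c.1 (divisors (c.1 * c.2))).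
have mem_div a b : a \in s -> b \in s -> a \in divisors (a * b).
  by move=> /s0 a0 /s0 b0; rewrite -dvdn_divisors ?muln_gt0 ?a0 ?dvdn_mulr.
rewrite -(size_map f); apply: uniq_leq_size.
  rewrite map_inj_in_uniq.
    by apply: allpairs_uniq => // -[? ?] [? ?] _ _ [-> ->].
  move=> _ _ /allpairsP[[a b] /= [a1 b1 ->]] /allpairsP[[c d] /= [c1 d1 ->]].
  rewrite /f /= => -[E1 E2]; have Eac : a = c.
    have := congr1 (nth 0 (divisors (c * d))) E2.
    by rewrite -{1}E1 !nth_index ?mem_div.
  congr pair => //; move: E1; rewrite Eac => /eqP.
  by rewrite eqn_pmul2l ?s0 // => /eqP.
move=> _ /mapP[_ /allpairsP[[a b] /= [a1 b1 ->]] ->]; rewrite /f /=.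
apply: allpairs_f; first by rewrite mem_undup; apply: allpairs_f.
by rewrite mem_iota add0n (leq_trans _ (sT a b a1 b1)) // index_mem mem_div.
Qed.

(** * Chebyshev's lower bound for the number of primes *)

Definition prime_pi (n : nat) : nat := #|[set p : 'I_n.+1 | prime p]%SET|.

(** Legendre's formula padded with zero terms, so that the sums for m! and (2m)! share one range. *)
Lemma logn_fact_widen (p m n : nat) : prime p -> m <= n ->
  logn p m`! = \sum_(1 <= k < n.+1) m %/ p ^ k.
Proof.
move=> pp mn; rewrite logn_fact // [RHS](@big_cat_nat _ _ _ m.+1) //=.
rewrite [X in _ + X]big1_seq ?addn0 // => k.
rewrite mem_index_iota => /andP[_ /andP[mk _]].
by rewrite divn_small // (ltn_trans mk) // ltn_expl // prime_gt1.
Qed.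

(** By Legendre, the exponent of [p] is the sum over k of floor(2m/p^k) - 2 floor(m/p^k). Each term
    is at most 1 and vanishes once p^k > 2m. *)
Lemma logn_bin_le (p m : nat) : prime p -> 0 < m ->
  p ^ logn p 'C(m.*2, m) <= m.*2.
Proof.
move=> pp m0; have m20 : 0 < m.*2 by rewrite double_gt0.
have le_m : m <= m.*2 by rewrite -addnn leq_addr.
apply: leq_trans (trunc_logP (prime_gt1 pp) m20).
rewrite leq_exp2l ?prime_gt1 //.
have := congr1 (logn p) (bin_fact le_m).
rewrite -[m.*2 - m]/(_) -{2}addnn addnK !lognM ?muln_gt0 ?fact_gt0 ?bin_gt0 //.
rewrite (logn_fact_widen _ _ _ pp le_m) logn_fact // => E.
have le_trunc t n : \sum_(1 <= k < n.+1) (k <= t) <= minn n t.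
  elim: n => [|n IHn]; first by rewrite big_geq.
  rewrite big_nat_recr //=; case: (leqP n.+1 t) IHn; lia.
apply: leq_trans (leq_trans (le_trunc _ m.*2) (geq_minr _ _)).
rewrite -(leq_add2r (\sum_(1 <= k < m.*2.+1) m %/ p ^ k +
    \sum_(1 <= k < m.*2.+1) m %/ p ^ k)) {}E.
rewrite -!big_split !big_nat /=; apply: leq_sum => k /andP[k1 _].
have q0 : 0 < p ^ k by rewrite expn_gt0 prime_gt0.
have [pk|pk] := leqP k (trunc_log p m.*2).
  rewrite -addnn {1}(divn_eq m (p ^ k)).
  have := ltn_pmod m q0.
  move: (m %/ p ^ k) (m %% p ^ k) (p ^ k) q0 => a b c c0 bc.
  rewrite -ltnS ltn_divLR //; nia.
rewrite !divn_small // ltnNge; apply: contraL pk => H; rewrite -leqNgt.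
- by apply: trunc_log_max; rewrite ?prime_gt1 // (leq_trans H).
- by apply: trunc_log_max; rewrite ?prime_gt1.
Qed.

Lemma bin_central_ge (m : nat) : 2 ^ m <= 'C(m.*2, m).
Proof.
elim: m => // m IH.
have E : 'C(m.*2.+2, m.+1) = 2 * 'C(m.*2.+1, m).
  apply/eqP; rewrite -(eqn_pmul2l (ltn0Sn m)) -mul_bin_diag /=.
  by rewrite mulnA (mulnC m.+1) mul2n doubleS.
by rewrite doubleS E expnS leq_mul2l (leq_trans IH) // leq_bin2l.
Qed.

(** With m = floor(n/2), the binomial C(2m, m) is at least 2^m and is a product of at most pi(n)
    prime powers, each at most [n]. *)
Lemma exp_half_le_prime_pi (n : nat) : 0 < n -> 2 ^ n./2 <= n ^ prime_pi n.
Proof.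
case: n => [//|[_|n _]]; first by rewrite exp1n.
set N := n.+2; set m := N./2.
have m0 : 0 < m by [].
have mN : m.*2 <= N by rewrite -[leqRHS]odd_double_half leq_addl.
apply: leq_trans (bin_central_ge m) _.
have C0 : 0 < 'C(m.*2, m) by rewrite bin_gt0 -addnn leq_addr.
set c := 'C(_, _) in C0 *.
have prime_le p : p \in primes c -> p <= N.
  move=> pc; have pp : prime p by move: pc; rewrite mem_primes => /andP[].
  apply: leq_trans (leq_trans (logn_bin_le _ _ pp m0) mN).
  by rewrite -[leqLHS]expn1 leq_exp2l ?prime_gt1 // logn_gt0.
have size_primes : size (primes c) <= prime_pi N.
  rewrite /prime_pi cardE -(size_map val); apply: uniq_leq_size => [|p pc].
    exact: primes_uniq.
  have := prime_le p pc; rewrite -ltnS => pN.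
  apply/mapP; exists (Ordinal pN) => //.
  by rewrite mem_enum inE /=; move: pc; rewrite mem_primes => /andP[].
apply: (@leq_trans (N ^ size (primes c))); last by rewrite leq_exp2l.
rewrite [leqLHS]prod_prime_decomp // prime_decompE big_map /=.
rewrite -sum1_size (@big_morph _ _ (expn N) 1 muln 0 addn) //; last first.
  by move=> i j; rewrite expnD.
rewrite !big_seq; apply: leq_prod => p; rewrite mem_primes => /andP[pp _].
by rewrite expn1 (leq_trans (logn_bin_le _ _ pp m0)).
Qed.

(** The falling factorial C(n, k) k! has [k] factors, each at least n - k + 1, while k! <= k^k. *)
Lemma bin_ge_exp (n k : nat) : k <= n -> (n - k).+1 ^ k <= 'C(n, k) * k ^ k.
Proof.
move=> kn; apply: (@leq_trans (n ^_ k)); last first.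
  rewrite -bin_ffact leq_mul // fact_prod.
  rewrite -[X in _ <= _ ^ X](subn1 k.+1) -prod_nat_const_nat.
  rewrite !big_nat; apply: leq_prod => i /andP[_].
  by rewrite ltnS.
rewrite ffact_prod -[X in _ ^ X]card_ord -prod_nat_const.
apply: leq_prod => i _; have := ltn_ord i; lia.
Qed.

(** * Counting smooth numbers *)

Lemma prime_dvd_prod_ord (Y : nat) (B : {set 'I_Y.+1}) (q : nat) : prime q ->
  q %| \prod_(p in B) p -> exists2 p : 'I_Y.+1, p \in B & q %| p.
Proof.
move=> pq; rewrite Euclid_dvd_prod // big_orE => /exists_inP[p pB qp].
by exists p.
Qed.

(** By unique factorization, distinct [u]-element sets of primes up to [Y] have distinct products;
    these are [Y]-smooth and at most [Y ^ u]. *)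
Lemma bin_prime_pi_le (Y u : nat) (s : seq nat) : 0 < Y ->
  (forall n, 0 < n -> n <= Y ^ u -> max_pdiv n <= Y -> n \in s) ->
  'C(prime_pi Y, u) <= size s.
Proof.
move=> Y0 hs; rewrite -cards_draws; set F := finset _.
pose f (B : {set 'I_Y.+1}) := \prod_(p in B) (p : nat).
have memF B : B \in F -> {in B, forall p : 'I_Y.+1, prime p} /\ #|B| = u.
  rewrite inE => /andP[/fintype.subsetP BD /eqP ?]; split=> // p /BD.
  by rewrite inE.
rewrite cardE -(size_map f); apply: uniq_leq_size.
  rewrite map_inj_in_uniq ?enum_uniq // => A B.
  rewrite !mem_enum => /memF[pA _] /memF[pB _] E.
  have sub (A' B' : {set 'I_Y.+1}) : {in A', forall p : 'I_Y.+1, prime p} ->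
      {in B', forall p : 'I_Y.+1, prime p} -> f A' = f B' -> A' \subset B'.
    move=> pA' pB' E'; apply/fintype.subsetP => p pA1.
    have [|q qB] := @prime_dvd_prod_ord Y B' p (pA' p pA1).
      by rewrite -[X in _ %| X]/(f B') -E' /f (bigD1 p) //= dvdn_mulr.
    by rewrite dvdn_prime2 ?(pA' p) ?(pB' q) // => /eqP/val_inj ->.
  by apply/eqP; rewrite finset.eqEsubset !sub.
move=> n /mapP[B]; rewrite mem_enum => /memF[pB uB] ->.
have fB0 : 0 < f B by apply: prodn_cond_gt0 => p /pB /prime_gt0.
apply: hs => //.
  rewrite -uB -prod_nat_const; apply: leq_prod => p _.
  by rewrite -ltnS ltn_ord.
(* The empty product ([u = 0]) has no prime divisor and is treated apart. *)
have [fB1|fB1] := leqP (f B) 1.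
  by rewrite (leq_trans (max_pdiv_leq fB0)) // (leq_trans fB1).
have [p pB1 H] :=
  prime_dvd_prod_ord Y B _ (max_pdiv_prime fB1) (max_pdiv_dvd _).
by rewrite (leq_trans (dvdn_leq (prime_gt0 (pB p pB1)) H)) // -ltnS ltn_ord.
Qed.

(** Converts the exponent floor(Y/2) of Chebyshev's bound into a multiple of a real y < Y + 1. *)
Lemma succn_le_4half (n : nat) : 2 <= n -> n.+1 <= 4 * n./2.
Proof. lia. Qed.

(** * Product sets *)

Lemma mem_product_set_seq (A : set nat) (n : nat) : finite_set A ->
  (n \in fset_set (product_set A A)) =
  (n \in undup [seq a * b | a <- fset_set A, b <- fset_set A]).
Proof.
move=> finA; rewrite in_fset_set; last exact: finite_product_set.
rewrite mem_undup; apply/idP/allpairsP => [|[[a b] /= [aA bA ->]]].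
  rewrite inE => -[a Aa [b Ab <-]]; exists (a, b) => /=.
  by rewrite !in_fset_set // !inE.
rewrite inE; move: aA bA; rewrite !in_fset_set // !inE => aA bA.
by exists a => //; exists b.
Qed.

Lemma set_card_product_set (A : set nat) : finite_set A ->
  set_card (product_set A A) =
  size (undup [seq a * b | a <- fset_set A, b <- fset_set A]).
Proof.
move=> finA; apply/perm_size/uniq_perm; rewrite ?undup_uniq ?fset_uniq // => n.
exact: mem_product_set_seq.
Qed.

Lemma set_card_product_set_le (A : set nat) : finite_set A ->
  set_card (product_set A A) <= set_card A ^ 2.
Proof.
move=> finA; rewrite set_card_product_set // (leq_trans (size_undup _)) //.
by rewrite size_allpairs mulnn.
Qed.

Lemma set_card_product_set_ge (A : set nat) (T : nat) : finite_set A ->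
  (forall a, A a -> 0 < a) ->
  (forall a b, A a -> A b -> size (divisors (a * b)) <= T) ->
  set_card A ^ 2 <= set_card (product_set A A) * T.
Proof.
move=> finA A0 AT; rewrite set_card_product_set //.
apply: size_undup_products => [|a|a b];
  rewrite ?fset_uniq // !in_fset_set // !inE.
  exact: A0.
exact: AT.
Qed.

(** * Logarithmic bounds *)

Local Open Scope classical_set_scope.
Local Open Scope ring_scope.

Lemma bin_prime_pi_le_Psi (R : realType) (x y : R) (Y u : nat) : (0 < Y)%N ->
  Y%:R <= y -> Y%:R ^+ u <= x -> ('C(prime_pi Y, u) <= Psi x y)%N.
Proof.
move=> Y0 Yy Yx; apply: bin_prime_pi_le => // n n0 nY Pn.
rewrite in_fset_set; last exact: finite_smooth_set.
rewrite inE; split=> //; last by rewrite (le_trans _ Yy) // ler_nat.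
by rewrite (le_trans _ Yx) // -natrX ler_nat.
Qed.

Lemma ln2_ge_half (R : realType) : 2^-1 <= ln (2 : R).
Proof.
have := @le_ln1Dx R (- 2^-1); have -> : 1 - 2^-1 = 2^-1 :> R by lra.
rewrite lnV ?posrE //; lra.
Qed.

Lemma ln_size_divisors_le (R : realType) (x : R) (n : nat) :
  16 <= ln x -> (0 < n)%N -> n%:R <= x ^+ 2 ->
  ln (size (divisors n))%:R * ln (ln x) <= 68 * ln x.
Proof.
move=> l16 n0 nx; set l := ln x in l16 *.
have x0 : 0 < x by rewrite ltNge; apply/negP => /ln0; rewrite -/l; lra.
have xE : x = expR l by rewrite lnK.
(* With l = t^4 and primes split at P ~ t^2, the term P * ln L times ln t is
   O((t * ln t)^2) = O(l). *)
pose t := Num.sqrt (Num.sqrt l).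
have l0 : 0 <= l by lra.
have t0 : 0 <= t by rewrite sqrtr_ge0.
have lE : l = t ^+ 4 by rewrite (exprM t 2 2) !sqr_sqrtr ?sqrtr_ge0.
have t2 : 2 <= t.
  by rewrite -(@ler_pXn2r _ 4) ?nnegrE // -lE; lra.
have tp : 0 < t by lra.
have lnlE : ln l = 4 * ln t by rewrite lE lnXn ?mulr_natl //; lra.
have lnt0 : 0 < ln t by rewrite ln_gt0; lra.
have lnt : ln t <= t.
  by have := @le_ln1Dx R (t - 1); rewrite addrCA subrr addr0; lra.
(* The factor 4 ensures [n <= 2 ^ L]: since ln 2 >= 1/2, L ln 2 >= 2l. *)
pose P := (Num.truncn (t ^+ 2)).+1; pose L := (Num.truncn (4 * l)).+1.
have /andP[P1 P2] := truncn_itv (exprn_ge0 2 t0).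
have /andP[L1 L2] : (Num.truncn (4 * l))%:R <= 4 * l < L%:R.
  by apply: truncn_itv; lra.
have ln2 := ln2_ge_half R.
have [|k] := @size_divisors_le P L n n0.
  rewrite -(ler_nat R) natrX (le_trans nx) // xE -expRM_natl.
  rewrite -ler_ln ?posrE ?expR_gt0 ?exprn_gt0 //.
  rewrite expRK lnXn // -[leRHS]mulr_natl.
  have : L%:R * 2^-1 <= L%:R * ln 2 :> R by apply: ler_wpM2l.
  lra.
set d := size (divisors n) => -[Hd HP].
have d0 : 0 < d%:R :> R by rewrite ltr0n size_divisors_gt0.
have P0 : 0 < P%:R :> R by rewrite ltr0n.
have lnP : 2 * ln t <= ln P%:R.
  by rewrite mulr_natl -lnXn // ler_ln ?posrE ?exprn_gt0 // ltW.
have kl : k%:R * ln t <= l.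
  have : ln (P ^ k)%:R <= ln (x ^+ 2).
    rewrite ler_ln ?posrE ?exprn_gt0 // ?ltr0n ?expn_gt0 //.
    by rewrite (le_trans _ nx) // ler_nat.
  rewrite natrX !lnXn // -[leLHS]mulr_natl -[leRHS]mulr_natl -/l.
  by have := ler_wpM2l (ler0n R k) lnP; lra.
(* Indeed L + 1 <= 4l + 2 <= 16l <= l^2 = t^8. *)
have lnL : ln L.+1%:R <= 8 * ln t.
  rewrite mulr_natl -lnXn // ler_ln ?posrE ?exprn_gt0 //.
  rewrite (exprM t 4 2) -lE expr2 (le_trans _ (ler_wpM2r l0 l16)) //.
  by rewrite -natr1 -/L /L -natr1; lra.
have P2t : P%:R <= 2 * t ^+ 2.
  have : 2 ^+ 2 <= t ^+ 2 by rewrite lerXn2r ?nnegrE.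
  by rewrite /P -natr1; lra.
have Hln : ln d%:R <= P%:R * ln L.+1%:R + k%:R * ln 2 :> R.
  have : d%:R <= L.+1%:R ^+ P * 2 ^+ k :> R by rewrite -!natrX -natrM ler_nat.
  rewrite -ler_ln ?posrE ?mulr_gt0 ?exprn_gt0 //.
  by rewrite lnM ?posrE ?exprn_gt0 // !lnXn // !mulr_natl.
have lnL0 : 0 <= ln L.+1%:R :> R by rewrite ln_ge0 // ler1n.
have ln21 : ln 2 <= 1 :> R.
  by have := @le_ln1Dx R 1; have -> : 1 + 1 = 2 :> R by []; lra.
have k0 : 0 <= k%:R :> R by [].
have Hln' : ln d%:R <= 16 * t ^+ 2 * ln t + k%:R.
  apply: le_trans Hln _; apply: lerD; last by rewrite ler_piMr.
  have -> : 16 * t ^+ 2 * ln t = (2 * t ^+ 2) * (8 * ln t) by ring.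
  by apply: ler_pM.
rewrite lnlE.
(* Here 17 = 16 + 1: the small primes give 16 t^2 (ln t)^2 <= 16 l and the large ones k ln t <= l.
   Then ln l = 4 ln t yields 68. *)
have : ln d%:R * ln t <= 17 * l; last lra.
have : ln t ^+ 2 <= t ^+ 2 by rewrite lerXn2r ?nnegrE //; lra.
have : ln d%:R * ln t <= (16 * t ^+ 2 * ln t + k%:R) * ln t by rewrite ler_pM2r.
have t20 : 0 <= t ^+ 2 by rewrite exprn_ge0.
move=> H1 /(ler_wpM2l t20) H2; rewrite lE; move: kl; rewrite lE => kl.
have -> : 17 * t ^+ 4 = 16 * (t ^+ 2 * t ^+ 2) + t ^+ 4 by ring.
apply: le_trans H1 _; rewrite mulrDl lerD //.
have -> : 16 * t ^+ 2 * ln t * ln t = 16 * (t ^+ 2 * ln t ^+ 2) by ring.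
by rewrite ler_pM2l.
Qed.

(** With K = y / ln x and u = floor(ln x / ln y), Psi(x, y) >= C(pi(y), u) >= (K/16)^u. The factor 4
    comes from ln x <= 2u ln y and ln K <= 2 ln(K/16). *)
Lemma ln_Psi_ge (R : realType) (x y : R) :
  16 <= ln x -> 2 <= y <= x -> 256 <= y / ln x ->
  ln x * ln (y / ln x) <= 4 * (ln y * ln (Psi x y)%:R).
Proof.
(* The threshold 256 = 16^2 is what makes ln K <= 2 ln(K/16). *)
have sq (k : R) : 256 <= k -> k <= (k / 16) ^+ 2 by nra.
have arith (m u v a b F : R) : 0 <= u -> 0 <= v -> 0 <= a ->
    m <= 2 * u * v -> a <= 2 * b -> u * b <= F -> m * a <= 4 * (v * F).
  move=> u0 v0 a0 Hm Ha HF; have uv0 := mulr_ge0 u0 v0.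
  have := ler_wpM2r a0 Hm; have := ler_wpM2l uv0 Ha; have := ler_wpM2l v0 HF.
  lra.
move=> l16 /andP[y2 yx] kge.
set l := ln x in l16 kge *; set K := y / l in kge *.
have l0 : 0 < l by lra.
have K0 : 0 < K by lra.
have K1 : 1 <= K by lra.
have x0 : 0 < x by lra.
have y0 : 0 < y by lra.
have yE : y = K * l by rewrite divfK ?gt_eqF.
have v0 : 0 < ln y by apply: ln_gt0; lra.
have vl : ln y <= l by rewrite ler_ln ?posrE.
pose Y := Num.truncn y; pose u := Num.truncn (l / ln y).
have /andP[Y1 Y2] : Y%:R <= y < Y.+1%:R by apply: truncn_itv; lra.
have /andP[u1 u2] : u%:R <= l / ln y < u.+1%:R.
  by apply: truncn_itv; rewrite divr_ge0 // ltW.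
have uge1 : (0 < u)%N by rewrite truncn_gt0 ler_pdivlMr // mul1r.
have u0 : 0 < u%:R :> R by rewrite ltr0n.
have uge1R : 1 <= u%:R :> R by rewrite ler1n.
have Yge2 : (2 <= Y)%N by rewrite truncn_ge_nat // ltW.
have Y0 : (0 < Y)%N by apply: ltn_trans Yge2.
have lnY : ln Y%:R <= ln y by rewrite ler_ln ?posrE // ltr0n.
have lnY0 : 0 <= ln Y%:R :> R by rewrite ln_ge0 // ler1n.
have ul : u%:R * ln y <= l by rewrite -ler_pdivlMr.
have lu : l <= 2 * u%:R * ln y.
  rewrite -ler_pdivrMr // (le_trans (ltW u2)) // -natr1; lra.
set p := prime_pi Y.
(* The 8 combines floor(Y/2) >= y/4 with ln 2 >= 1/2. *)
have cheb : y / 8 <= p%:R * ln y.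
  have : ln ((2 : R) ^+ Y./2) <= ln (Y%:R ^+ p).
    rewrite ler_ln ?posrE ?exprn_gt0 ?ltr0n // -!natrX ler_nat.
    exact: exp_half_le_prime_pi.
  rewrite !lnXn ?ltr0n // -[leLHS]mulr_natl -[leRHS]mulr_natl.
  have half : y <= 4 * Y./2%:R.
    by apply: le_trans (ltW Y2) _; rewrite -natrM ler_nat succn_le_4half.
  have := ler_wpM2l (ler0n R Y./2) (ln2_ge_half R).
  have := ler_wpM2l (ler0n R p) lnY.
  lra.
(* Follows from u ln y <= l <= y/256 and [cheb]; it gives p - u + 1 >= p/2 in [powK]. *)
have up : 32 * u%:R <= p%:R :> R.
  have ly : 256 * l <= y by rewrite yE ler_pM2r.
  rewrite -(ler_pM2r v0); lra.
have upN : (u <= p)%N by rewrite -(ler_nat R); lra.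
have ratio : K / 16 <= (p%:R / 2) / u%:R.
  rewrite ler_pdivlMr // -(ler_pM2r v0).
  have K160 : 0 <= K / 16 by lra.
  have := ler_wpM2l K160 ul; lra.
have bin0 : (0 < 'C(p, u))%N by rewrite bin_gt0.
have binPsi : ('C(p, u) <= Psi x y)%N.
  apply: bin_prime_pi_le_Psi => //.
  rewrite -ler_ln ?posrE ?exprn_gt0 ?ltr0n // lnXn ?ltr0n //.
  rewrite -[leLHS]mulr_natl -/l.
  by have := ler_wpM2l (ltW u0) lnY; lra.
have powK : (K / 16) ^+ u <= 'C(p, u)%:R.
  have : (p%:R / 2) ^+ u <= 'C(p, u)%:R * u%:R ^+ u :> R.
    have := bin_ge_exp _ _ upN; rewrite -(ler_nat R) natrM !natrX.
    apply: le_trans; rewrite lerXn2r ?nnegrE ?ler0n ?divr_ge0 //.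
    have -> : (p - u).+1%:R = p%:R - u%:R + 1 :> R by rewrite -natr1 natrB.
    lra.
  rewrite -ler_pdivrMr ?exprn_gt0 // -expr_div_n; apply: le_trans.
  by rewrite lerXn2r ?nnegrE ?divr_ge0 // ltW.
have lnK : ln K <= 2 * ln (K / 16).
  rewrite mulr_natl -lnXn ?ler_ln ?posrE ?exprn_gt0 ?divr_gt0 //.
  exact: sq.
have lnPsi : u%:R * ln (K / 16) <= ln (Psi x y)%:R.
  rewrite mulr_natl -lnXn ?divr_gt0 // ler_ln ?posrE ?exprn_gt0 ?divr_gt0 //.
    by rewrite (le_trans powK) // ler_nat.
  by rewrite ltr0n (leq_trans bin0).
have lnK0 : 0 <= ln K by exact: ln_ge0.
by apply: arith lu lnK lnPsi => //; exact: ltW.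
Qed.

(** The divisor bound costs at most 68 l / ln l in the logarithm of the product set. Dividing by ln
    Psi >= l ln K / (4 ln y), where ln y = ln K + ln l, produces 272 = 4 * 68 and the two
    reciprocals. *)
Lemma product_set_ratio_bounds (R : realType) (x y : R) :
  16 <= ln x -> 2 <= y <= x -> 256 <= y / ln x ->
  2 - 272 * ((ln (ln x))^-1 + (ln (y / ln x))^-1) <=
  ln ((set_card (product_set (smooth_set x y) (smooth_set x y)))%:R : R) /
    ln ((Psi x y)%:R : R) <= 2.
Proof.
move=> l16 yx kge; have [y2 y_le_x] := andP yx.
have finS := finite_smooth_set x y; set S := smooth_set x y in finS *.
have lnPsi := ln_Psi_ge _ _ _ l16 yx kge.
set l := ln x in l16 kge lnPsi *; set K := y / l in kge lnPsi *.
have l0 : 0 < l by lra.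
have yE : y = K * l by rewrite divfK ?gt_eqF.
have lnl0 : 0 < ln l by apply: ln_gt0; lra.
have lnK0 : 0 < ln K by apply: ln_gt0; lra.
have lny : ln y = ln K + ln l by rewrite yE lnM ?posrE //; lra.
set F := ln (Psi x y)%:R in lnPsi *.
have F0 : 0 < F.
  have lny0 : 0 < ln y by lra.
  rewrite -(pmulr_rgt0 _ lny0) -(pmulr_rgt0 _ (_ : 0 < 4)) //.
  by apply: lt_le_trans lnPsi; rewrite mulr_gt0.
(* Since [ln] is 0 on nonpositive reals, a positive logarithm forces a positive argument. *)
have Psi0 : 0 < (Psi x y)%:R :> R.
  by rewrite ltNge; apply/negP => /ln0 E; move: F0; rewrite /F E ltxx.
have PsiN0 : (0 < Psi x y)%N by rewrite -(ltr0n R).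
pose E := expR (68 * l / ln l); pose T := Num.truncn E.
have ET : T%:R <= E by have /andP[] := truncn_itv (expR_ge0 (68 * l / ln l)).
have divT a b : S a -> S b -> (size (divisors (a * b)) <= T)%N.
  move=> [a0 ax _] [b0 bx _]; have ab0 : (0 < a * b)%N by rewrite muln_gt0 a0.
  rewrite truncn_ge_nat ?expR_ge0 // -ler_ln ?posrE ?expR_gt0 //; last first.
    by rewrite ltr0n size_divisors_gt0.
  rewrite expRK ler_pdivlMr //; apply: ln_size_divisors_le => //.
  by rewrite natrM expr2 ler_pM.
have := set_card_product_set_ge _ _ finS (fun a '(And3 a0 _ _) => a0) divT.
have := set_card_product_set_le _ finS.
rewrite -/(Psi x y); set N := set_card (product_set S S) => le_N ge_N.
have NT0 : (0 < N * T)%N.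
  by rewrite (leq_trans _ ge_N) // expn_gt0 -(ltr0n R) Psi0.
have [N0 T0] : (0 < N)%N /\ (0 < T)%N by apply/andP; rewrite -muln_gt0.
rewrite ler_pdivlMr // ler_pdivrMr //; apply/andP; split; last first.
  rewrite mulr_natl -lnXn // ler_ln ?posrE ?ltr0n ?exprn_gt0 //.
  by rewrite -natrX ler_nat.
have H1 : 2 * F <= ln N%:R + 68 * l / ln l.
  rewrite mulr_natl -lnXn // -[X in _ + X]expRK -lnM ?posrE ?expR_gt0 ?ltr0n //.
  rewrite ler_ln ?posrE ?exprn_gt0 ?mulr_gt0 ?expR_gt0 ?ltr0n //.
  apply: (@le_trans _ _ (N%:R * T%:R)); last by rewrite ler_wpM2l.
  by rewrite -natrX -natrM ler_nat.
have H2 : 68 * l / ln l <= 272 * ((ln l)^-1 + (ln K)^-1) * F.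
  rewrite ler_pdivrMr // -(ler_pM2r lnK0).
  have -> : 272 * ((ln l)^-1 + (ln K)^-1) * F * ln l * ln K =
      68 * (4 * ((ln K + ln l) * F)).
    by field; rewrite !gt_eqF.
  by rewrite -lny; lra.
by rewrite mulrBl lerBlDr (le_trans H1) // lerD2l.
Qed.

(** * Passage to the limit *)

Lemma cvgr_ln_pinfty (R : realType) :
  ln x @[x --> +oo] --> (+oo : set_system R).
Proof.
apply/cvgryPge => A; near=> x.
rewrite -[A]expRK ler_ln ?posrE ?expR_gt0 //.
Unshelve. all: by end_near. Qed.

Theorem theorem6 (R : realType) (y : R -> R)
    (hy : \forall x \near +oo, 2 <= y x <= x)
    (hlim : y x / ln x @[x --> +oo] --> +oo) :
  ln ((set_card (product_set (smooth_set x (y x)) (smooth_set x (y x))))%:R : R)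
    / ln ((Psi x (y x))%:R : R) @[x --> +oo] --> (2 : R).
Proof.
have inv_ln (f : R -> R) : f x @[x --> +oo] --> +oo ->
    (ln (f x))^-1 @[x --> +oo] --> 0.
  move=> cf; have cln := cvg_comp _ _ cf (cvgr_ln_pinfty R).
  apply/gtr0_cvgV0 => //.
  by have /cvgryPgt/(_ 0) := cln.
(* The error vanishes by [inv_ln] applied to ln x and to y / ln x; both also eventually exceed the
   thresholds 16 and 256. *)
apply: (@squeeze_cvgr _ _ _ R
  (fun x => 2 - 272 * ((ln (ln x))^-1 + (ln (y x / ln x))^-1)) (cst 2)).
- near=> x; apply: product_set_ratio_bounds; near: x.
  + by have /cvgryPge/(_ 16) := cvgr_ln_pinfty R.
  + exact: hy.
  + by have /cvgryPge/(_ 256) := hlim.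
- rewrite -[X in _ --> X]subr0 -[X in _ - X](mulr0 272) -[X in 272 * X]addr0.
  apply: cvgB; first exact: cvg_cst.
  apply: cvgM; first exact: cvg_cst.
  by apply: cvgD; apply: inv_ln => //; exact: cvgr_ln_pinfty.
- exact: cvg_cst.
Unshelve. all: by end_near. Qed.
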